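(* Let $0\le p\le1$ and let $U\in O(2)$ be either $\begin{pmatrix}\cos\theta&-\sin\theta\\ \sin\theta&\cos\theta\end{pmatrix}$ or $\begin{pmatrix}\cos\theta&\sin\theta\\ \sin\theta&-\cos\theta\end{pmatrix}$. Consider the decoherent quantum walk with coin operator $U$ and initial coin state $\phi_0=c_R|R\rangle+c_L|L\rangle$, $|c_R|^2+|c_L|^2=1$. (a) If $\theta=0$ or $\theta=\pi$, then for all real $\nu$ and all integers $t\ge1$, $$\hat P\Big(\frac{\nu}{t},t\Big)=|c_R|^2e^{i\nu}+|c_L|^2e^{-i\nu}.$$ (b) If $\theta=\frac{\pi}{2}$ or $\theta=\frac{3\pi}{2}$, then for every $\kappa>0$ and all real $\nu$, $$\lim_{t\to\infty}\hat P\Big(\frac{\nu}{t^{\kappa}},t\Big)=1.$$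
   Context: Decoherent quantum walk on the line: the state space is $H_p\otimes H_2$, where $H_p$ has basis $|x\rangle$, $x\in\mathbb{Z}$, and the coin space $H_2=\mathbb{C}^2$ has orthonormal basis $|R\rangle,|L\rangle$ (in this order for matrices). $P_R=|R\rangle\langle R|$, $P_L=|L\rangle\langle L|$, $S^{\pm}|x\rangle=|x\pm1\rangle$, and $E=(S^+\otimes P_R+S^-\otimes P_L)(I\otimes U)$. The measurement operators are $A_0=\sqrt{1-p}\,I$, $A_1=\sqrt p\,|R\rangle\langle R|$, $A_2=\sqrt p\,|L\rangle\langle L|$, and one step of the walk maps a density operator $\rho$ to $\sum_{n=0}^2E(I\otimes A_n)\rho(I\otimes A_n)^*E^*$. The walk starts at $|0\rangle\otimes|\phi_0\rangle$; $\rho_t$ is the state after $t$ steps, $p(x,t)=\mathrm{Tr}\{(|x\rangle\langle x|\otimes I)\rho_t\}$, and $\hat P(\nu,t)=\sum_{x\in\mathbb{Z}}e^{i\nu x}p(x,t)$. *)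

(* Defs.v *)
From HB Require Import structures.
From mathcomp Require Import all_boot all_order all_algebra.
From mathcomp Require Import complex.
From mathcomp Require Import all_classical all_reals all_analysis.
From mathcomp Require Import zify.

Set Implicit Arguments.
Unset Strict Implicit.
Unset Printing Implicit Defensive.

Import Order.TTheory GRing.Theory Num.Theory.
Import numFieldNormedType.Exports.

Local Open Scope classical_set_scope.
Local Open Scope ring_scope.
Local Open Scope complex_scope.
Local Open Scope sesquilinear_scope.

(* An operator on H_p is given by its matrix elements T x y = <x|T|y>, and an
   operator on H_p (x) H_2 by its 2x2 blocks A x y = <x|A|y>, whose entries are
   taken in the coin basis |R>, |L> = indices 0, 1.

   The sums over Z below are the finitely supported sums of fsbigop, whose value
   is 0 when infinitely many terms are nonzero. Every walk operator has finitely
   many nonzero blocks in each row and column, and the state after t steps lives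
   on the positions -t, ..., t (see rho_supp), so none of these sums is in that
   junk case. *)
Section Operators.
Variable C : numClosedFieldType.

Definition pos_op := int -> int -> C.
Definition op := int -> int -> 'M[C]_2.

Definition tens (T : pos_op) (M : 'M[C]_2) : op := fun x y => T x y *: M.
Definition op_add (A B : op) : op := fun x y => A x y + B x y.
Definition op_mul (A B : op) : op :=
  fun x y => \sum_(z \in [set: int]) A x z *m B z y.
Definition op_adj (A : op) : op := fun x y => (A y x)^t*.
Definition op_tr (A : op) : C := \sum_(x \in [set: int]) \tr (A x x).

Definition pos_id : pos_op := fun x y => (x == y)%:R.
(* S^+ |y> = |y + 1> and S^- |y> = |y - 1> *)
Definition shiftp : pos_op := fun x y => (x == y + 1)%:R.
Definition shiftm : pos_op := fun x y => (x == y - 1)%:R.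
(* |z><z| *)
Definition pos_proj (z : int) : pos_op := fun x y => ((x == z) && (y == z))%:R.

Definition projR : 'M[C]_2 := delta_mx 0 0.
Definition projL : 'M[C]_2 := delta_mx 1 1.

Definition ket (cR cL : C) : 'cV[C]_2 := \col_i (if i == 0 then cR else cL).

Definition walkE (U : 'M[C]_2) : op :=
  op_mul (op_add (tens shiftp projR) (tens shiftm projL)) (tens pos_id U).

End Operators.

Section Walk.
Variable R : realType.
Local Notation C := (R[i]).

Definition meas (p : R) (n : 'I_3) : 'M[C]_2 :=
  [:: (Num.sqrt (1 - p))%:C *: 1%:M;
      (Num.sqrt p)%:C *: projR C;
      (Num.sqrt p)%:C *: projL C]`_n.

Definition step (p : R) (U : 'M[C]_2) (rho : op C) : op C := fun x y =>
  \sum_(n < 3)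
    let B := op_mul (walkE U) (tens (@pos_id C) (meas p n)) in
    op_mul (op_mul B rho) (op_adj B) x y.

(* |0><0| (x) |phi_0><phi_0| *)
Definition rho0 (cR cL : C) : op C :=
  tens (pos_proj C 0) (ket cR cL *m (ket cR cL)^t*).

Definition rho (p : R) (U : 'M[C]_2) (cR cL : C) (t : nat) : op C :=
  iter t (step p U) (rho0 cR cL).

Definition prob (p : R) (U : 'M[C]_2) (cR cL : C) (x : int) (t : nat) : C :=
  op_tr (op_mul (tens (pos_proj C x) 1%:M) (rho p U cR cL t)).

Definition expi (a : R) : C := cos a +i* sin a.

Definition Phat (p : R) (U : 'M[C]_2) (cR cL : C) (nu : R) (t : nat) : C :=
  \sum_(x \in [set: int]) expi (nu * x%:~R) * prob p U cR cL x t.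

Definition mx22 (a b c d : R) : 'M[R]_2 :=
  \matrix_(i, j) (if i == 0 then (if j == 0 then a else b)
                  else (if j == 0 then c else d)).

Definition rotation (theta : R) : 'M[R]_2 :=
  mx22 (cos theta) (- sin theta) (sin theta) (cos theta).
Definition reflection (theta : R) : 'M[R]_2 :=
  mx22 (cos theta) (sin theta) (sin theta) (- cos theta).

Definition complex_mx (M : 'M[R]_2) : 'M[C]_2 := map_mx (fun a : R => a%:C) M.

Lemma fsum1 (V : zmodType) (a : int) (F : int -> V) :
  (forall z, z != a -> F z = 0) -> \sum_(z \in [set: int]) F z = F a.
Proof.
move=> h; rewrite (fsbigE [:: a]) ?big_cons ?big_nil ?in_setT /= ?addr0 //.
by move=> i _; rewrite inE => /h.
Qed.

Lemma fsum_neq0 (V : zmodType) (F : int -> V) :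
  \sum_(z \in [set: int]) F z != 0 -> exists z, F z != 0.
Proof.
move=> /eqP h; apply: contrapT => nex; apply: h; apply: fsbig1 => z _.
by apply: contrapT => /eqP Fz; apply: nex; exists z.
Qed.

Lemma op_mulI (A : op C) (M : 'M[C]_2) x y :
  op_mul A (tens (@pos_id C) M) x y = A x y *m M.
Proof.
rewrite /op_mul (fsum1 (a := y)) /tens /pos_id => [|z /negPf zy].
  by rewrite eqxx scale1r.
by rewrite zy scale0r mulmx0.
Qed.

Lemma walkE_blocks (U : 'M[C]_2) x y :
  walkE U x y = (x == y + 1)%:R *: (projR C *m U)
              + (x == y - 1)%:R *: (projL C *m U).
Proof. by rewrite /walkE op_mulI mulmxDl -!scalemxAl. Qed.

Lemma walkE_supp (U M : 'M[C]_2) x y :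
  op_mul (walkE U) (tens (@pos_id C) M) x y != 0 -> `|x - y| <= 1.
Proof.
rewrite op_mulI walkE_blocks; have [->|_] := eqVneq x (y + 1).
  by rewrite addrAC subrr.
have [->|_] := eqVneq x (y - 1); first by rewrite addrAC subrr.
by rewrite !scale0r addr0 mul0mx eqxx.
Qed.

Lemma rho_supp (p : R) (U : 'M[C]_2) (cR cL : C) (t : nat) (x y : int) :
  rho p U cR cL t x y != 0 -> (`|x| <= t%:Z) && (`|y| <= t%:Z).
Proof.
elim: t x y => [|t IH] x y /=.
  rewrite /rho /= /rho0 /tens /pos_proj; have [->|] := eqVneq x 0.
    by have [->|] := eqVneq y 0; rewrite ?scale0r ?eqxx.
  by rewrite scale0r eqxx.
rewrite /rho /= -/(rho p U cR cL t) /step => /eqP nz.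
have [n nzn] : exists n : 'I_3,
    let B := op_mul (walkE U) (tens (@pos_id C) (meas p n)) in
    op_mul (op_mul B (rho p U cR cL t)) (op_adj B) x y != 0.
  apply: contrapT => nex; apply: nz; apply: big1 => n _.
  by apply: contrapT => /eqP ?; apply: nex; exists n.
move: nzn => /= /fsum_neq0[z hz].
have /fsum_neq0[w hw] : op_mul (op_mul (walkE U)
    (tens (@pos_id C) (meas p n))) (rho p U cR cL t) x z != 0.
  by apply: contraNneq hz => ->; rewrite mul0mx.
have xw : `|x - w| <= 1.
  by apply: (@walkE_supp U (meas p n)); apply: contraNneq hw => ->; rewrite mul0mx.
have yz : `|y - z| <= 1.
  apply: (@walkE_supp U (meas p n)); apply: contraNneq hz => yz0.
  by rewrite /op_adj yz0 trmx0 map_mx0 mulmx0.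
have /IH/andP[wt zt] : rho p U cR cL t w z != 0.
  by apply: contraNneq hw => ->; rewrite mulmx0.
lia.
Qed.

End Walk.

(* Main.v *)
Require Import Defs.
From HB Require Import structures.
From mathcomp Require Import all_boot all_order all_algebra.
From mathcomp Require Import complex.
From mathcomp Require Import all_classical all_reals all_analysis.
From mathcomp Require Import zify ring.

Set Implicit Arguments.
Unset Strict Implicit.
Unset Printing Implicit Defensive.

Import Order.TTheory GRing.Theory Num.Theory.
Import numFieldNormedType.Exports.

Local Open Scope classical_set_scope.
Local Open Scope ring_scope.
Local Open Scope complex_scope.
Local Open Scope sesquilinear_scope.


(* One step moves the two coin components in opposite directions, so each
   diagonal coin entry of the new state at x only sees the block of the old state
   at the single site x - 1 or x + 1: coherences between distinct sites never
   matter. If U is diagonal or antidiagonal with entries of modulus 1, coherences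
   within a site do not matter either, and since sum_n A_n^* A_n = I the
   decoherence drops out: for a diagonal U the weights |c_R|^2 and |c_L|^2 travel
   ballistically to t and -t, while for an antidiagonal U they are exchanged at
   each step and the walk oscillates between 0 and {1, -1}. *)

(** * Finite sums and 2x2 coin matrices *)

Lemma fsum2 (V : zmodType) (a b : int) (F : int -> V) :
  a != b -> (forall z, z != a -> z != b -> F z = 0) ->
  \sum_(z \in [set: int]) F z = F a + F b.
Proof.
move=> ab F0; rewrite (fsbigE [:: a; b]).
- by rewrite !big_cons big_nil !in_setT /= addr0.
- by rewrite /= inE ab.
- by [].
- by move=> z _; rewrite !inE negb_or => /andP[]; exact: F0.
Qed.

Lemma sum_ord2 (V : nmodType) (F : 'I_2 -> V) : \sum_i F i = F 0 + F 1.
Proof.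
by rewrite 2!big_ord_recl big_ord0 addr0; congr (F _ + F _); exact: val_inj.
Qed.

Lemma ord2P (i : 'I_2) : {i = 0} + {i = 1}.
Proof. by case: i => [[|[|//]] ?]; [left|right]; exact: val_inj. Qed.

Section ConjClosed.
Variable C : numClosedFieldType.

Lemma delta_mulE (k i j : 'I_2) (M : 'M[C]_2) :
  (delta_mx k k *m M) i j = (i == k)%:R * M k j.
Proof.
rewrite mxE (bigD1 k) //= big1 ?addr0 => [|l lk]; first by rewrite mxE eqxx andbT.
by rewrite mxE (negPf lk) andbF mul0r.
Qed.

Lemma adjE (m n : nat) (M : 'M[C]_(m, n)) i j : M^t* i j = Num.conj (M j i).
Proof. by rewrite 2!mxE. Qed.

Lemma mul_delta_adjE (k i j : 'I_2) (M N : 'M[C]_2) :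
  (M *m (delta_mx k k *m N)^t*) i j = (j == k)%:R * (M *m N^t*) i k.
Proof.
rewrite !mxE mulr_sumr; apply: eq_bigr => l _.
by rewrite !adjE delta_mulE rmorphM rmorph_nat mulrCA.
Qed.

(** A projection on the left selects a row and its adjoint on the right a column. On the diagonal
    both must select the same index, so [b] and [c], which will be the coherences between [x - 1]
    and [x + 1], drop out. *)
Lemma proj_split (G a b c d : 'M[C]_2) i :
  ((projR C *m (G *m a) + projL C *m (G *m b)) *m (projR C *m G)^t*
   + (projR C *m (G *m c) + projL C *m (G *m d)) *m (projL C *m G)^t*) i i
  = (G *m (if i == 0 then a else d) *m G^t*) i i.
Proof.
have addE (M N : 'M[C]_2) k l : (M + N) k l = M k l + N k l by rewrite mxE.
rewrite addE (mul_delta_adjE 0) (mul_delta_adjE 1) !mulmxDl 2!addE.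
rewrite -!mulmxA.
rewrite (delta_mulE 0 i 0) (delta_mulE 1 i 0) (delta_mulE 0 i 1) (delta_mulE 1 i 1).
by case: (ord2P i) => -> /=; rewrite !(mul0r, mul1r, addr0, add0r).
Qed.

Lemma op_mul_shift (P Q : 'M[C]_2) (B A : op C) x y :
  (forall z, B x z = (x == z + 1)%:R *: P + (x == z - 1)%:R *: Q) ->
  op_mul B A x y = P *m A (x - 1) y + Q *m A (x + 1) y.
Proof.
move=> BE; rewrite /op_mul (fsum2 (a := x - 1) (b := x + 1)) ?BE.
- have -> : (x == x - 1 + 1) = true by lia.
  have -> : (x == x - 1 - 1) = false by lia.
  have -> : (x == x + 1 + 1) = false by lia.
  have -> : (x == x + 1 - 1) = true by lia.
  by rewrite !scale0r !scale1r add0r addr0.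
- by lia.
- move=> z za zb; rewrite BE.
  have -> : (x == z + 1) = false by lia.
  have -> : (x == z - 1) = false by lia.
  by rewrite !scale0r addr0 mul0mx.
Qed.

Lemma op_mul_shift_adj (P Q : 'M[C]_2) (B A : op C) x y :
  (forall z, B x z = (x == z + 1)%:R *: P + (x == z - 1)%:R *: Q) ->
  op_mul A (op_adj B) y x = A y (x - 1) *m P^t* + A y (x + 1) *m Q^t*.
Proof.
move=> BE; rewrite /op_mul /op_adj (fsum2 (a := x - 1) (b := x + 1)) ?BE.
- have -> : (x == x - 1 + 1) = true by lia.
  have -> : (x == x - 1 - 1) = false by lia.
  have -> : (x == x + 1 + 1) = false by lia.
  have -> : (x == x + 1 - 1) = true by lia.
  by rewrite !scale0r !scale1r add0r addr0.
- by lia.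
- move=> z za zb; rewrite BE.
  have -> : (x == z + 1) = false by lia.
  have -> : (x == z - 1) = false by lia.
  by rewrite !scale0r addr0 trmx0 map_mx0 mulmx0.
Qed.

(** Only row [i] of [G] enters this entry, from both sides; with one nonzero coefficient in that
    row, no off-diagonal entry of [M] can contribute. *)
Lemma conj_monomial_row (G M : 'M[C]_2) i k :
  (forall j, j != k -> G i j = 0) ->
  (G *m M *m G^t*) i i = `|G i k| ^+ 2 * M k k.
Proof.
move=> G0; rewrite mxE (bigD1 k) //= big1 => [|j jk]; last first.
  by rewrite adjE G0 // rmorph0 mulr0.
rewrite mxE (bigD1 k) //= big1 => [|j jk]; last by rewrite G0 // mul0r.
by rewrite adjE !addr0 normCK mulrAC.
Qed.

End ConjClosed.

(** * Evolution of the diagonal blocks under one step *)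

Section DiagonalBlocks.
Variable R : realType.
Local Notation C := (R[i]).

Lemma walk_stepE (U A : 'M[C]_2) x y :
  op_mul (walkE U) (tens (@pos_id C) A) x y
  = (x == y + 1)%:R *: (projR C *m (U *m A))
  + (x == y - 1)%:R *: (projL C *m (U *m A)).
Proof. by rewrite op_mulI walkE_blocks mulmxDl -!scalemxAl !mulmxA. Qed.

(** Coin state R (index 0) moves right, so its weight at [x] comes from [x - 1]; L comes from
    [x + 1]. *)
Definition incoming (i : 'I_2) (x : int) : int := if i == 0 then x - 1 else x + 1.

Lemma step_diag (p : R) (U : 'M[C]_2) (rho : op C) x i :
  step p U rho x x i i
  = \sum_(n < 3) (U *m meas p n *m rho (incoming i x) (incoming i x)
                  *m (U *m meas p n)^t*) i i.
Proof.
rewrite /step summxE; apply: eq_bigr => n _ /=.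
have BE := walk_stepE U (meas p n) x.
move: (op_mul _ _) (U *m meas p n) BE => B G BE.
rewrite (op_mul_shift_adj _ _ BE) !(op_mul_shift _ _ BE).
rewrite -!(mulmxA (projR C)) -!(mulmxA (projL C)).
by rewrite proj_split /incoming; case: (i == 0).
Qed.

(** Every measurement operator is diagonal, so it only rescales the columns of [U] and keeps its
    zero pattern. *)
Lemma mul_measE (p : R) (U : 'M[C]_2) (n : 'I_3) i j :
  (U *m meas p n) i j = U i j * meas p n j j.
Proof.
rewrite mxE (bigD1 j) //= big1 ?addr0 // => k kj.
suff -> : meas p n k j = 0 by rewrite mulr0.
case: n => [[|[|[|//]]] ?]; rewrite /meas /= !mxE.
- by rewrite (negPf kj) mulr0.
- by move: kj; case: (ord2P k) => ->; case: (ord2P j) => -> //=; rewrite ?mulr0.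
- by move: kj; case: (ord2P k) => ->; case: (ord2P j) => -> //=; rewrite ?mulr0.
Qed.

Lemma meas_complete (p : R) (k : 'I_2) : 0 <= p <= 1 ->
  \sum_(n < 3) `|meas p n k k| ^+ 2 = 1.
Proof.
move=> /andP[p0 p1].
have sqC (a : R) : 0 <= a -> `|(Num.sqrt a)%:C| ^+ 2 = a%:C.
  move=> a0; rewrite normc_def /= expr0n /= addr0 sqrtr_sqr.
  by rewrite ger0_norm ?sqrtr_ge0 // -rmorphXn sqr_sqrtr.
rewrite !big_ord_recl big_ord0 /meas /= !mxE !eqxx !mulr1 addr0 sqC ?subr_ge0 //.
case: (ord2P k) => -> /=; rewrite !mulr1 !mulr0 normr0 expr0n /= sqC //.
- by rewrite addr0 -rmorphD subrK.
- by rewrite add0r -rmorphD subrK.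
Qed.

(** [s i] is the column of the only nonzero entry in row [i] of [U]. The measurement outcomes then
    contribute weights summing to 1 by [meas_complete], and [p] disappears. *)
Lemma step_diag_monomial (p : R) (U : 'M[C]_2) (s : 'I_2 -> 'I_2) (rho : op C) x i :
  0 <= p <= 1 -> (forall j, j != s i -> U i j = 0) -> `|U i (s i)| ^+ 2 = 1 ->
  step p U rho x x i i = rho (incoming i x) (incoming i x) (s i) (s i).
Proof.
move=> hp U0 U1; rewrite step_diag.
under eq_bigr => n _.
  rewrite (@conj_monomial_row _ _ _ i (s i)); last first.
    by move=> j /U0 Uij; rewrite mul_measE Uij mul0r.
  rewrite mul_measE normrM exprMn U1 mul1r.
  over.
by rewrite -mulr_suml meas_complete // mul1r.
Qed.

(** * Position distribution and its Fourier transform *)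

Lemma rho0_diag (cR cL : C) x i :
  rho0 cR cL x x i i = (x == 0)%:R * `|if i == 0 then cR else cL| ^+ 2.
Proof.
rewrite /rho0 /tens /pos_proj andbb mxE; congr (_ * _).
by rewrite mxE big_ord1 adjE /ket !mxE normCK.
Qed.

Lemma probE (p : R) (U : 'M[C]_2) (cR cL : C) x t :
  prob p U cR cL x t = rho p U cR cL t x x 0 0 + rho p U cR cL t x x 1 1.
Proof.
have mulE y : op_mul (tens (pos_proj C x) 1%:M) (rho p U cR cL t) y y
    = (y == x)%:R *: rho p U cR cL t y y.
  rewrite /op_mul (fsum1 (a := x)) => [|z zx]; rewrite /tens /pos_proj; last first.
    by rewrite (negPf zx) andbF scale0r mul0mx.
  rewrite eqxx andbT -scalemxAl mul1mx.
  by case: eqP => [->|_] //; rewrite !scale0r.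
rewrite /prob /op_tr (fsum1 (a := x)) => [|z zx].
  by rewrite mulE eqxx scale1r /mxtrace sum_ord2.
by rewrite mulE (negPf zx) scale0r mxtrace0.
Qed.

Lemma Phat_two_points (p : R) (U : 'M[C]_2) (cR cL : C) nu t (m : int) (a b : C) :
  (forall x, rho p U cR cL t x x 0 0 = (x == m)%:R * a) ->
  (forall x, rho p U cR cL t x x 1 1 = (x == - m)%:R * b) ->
  Phat p U cR cL nu t = a * expi (nu * m%:~R) + b * expi (- (nu * m%:~R)).
Proof.
move=> h0 h1; have P x : prob p U cR cL x t = (x == m)%:R * a + (x == - m)%:R * b.
  by rewrite probE h0 h1.
rewrite -mulrN -mulrNz /Phat.
(* [m = - m] means [m = 0]: both weights sit at one site, and [fsum2], which needs distinct points,
   does not apply. *)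
have [m0|m0] := eqVneq m (- m).
  rewrite (fsum1 (a := m)) => [|z zm]; first by rewrite P -m0 eqxx !mul1r mulrC mulrDl.
  by rewrite P -m0 (negPf zm) !mul0r addr0 mulr0.
rewrite (fsum2 (a := m) (b := - m)) // => [|z zm zm'].
  rewrite !P !eqxx (negPf m0) eq_sym (negPf m0) !mul0r !mul1r addr0 add0r.
  by rewrite [a * _]mulrC [b * _]mulrC.
by rewrite P (negPf zm) (negPf zm') !mul0r addr0 mulr0.
Qed.

Lemma Phat_diagonal (p : R) (U : 'M[C]_2) (cR cL : C) nu t :
  0 <= p <= 1 -> U 0 1 = 0 -> U 1 0 = 0 ->
  `|U 0 0| ^+ 2 = 1 -> `|U 1 1| ^+ 2 = 1 ->
  Phat p U cR cL nu t
  = `|cR| ^+ 2 * expi (nu * t%:R) + `|cL| ^+ 2 * expi (- (nu * t%:R)).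
Proof.
move=> hp U01 U10 U00 U11; apply: (@Phat_two_points _ _ _ _ _ _ t%:Z).
- elim: t => [|t IH] x; first by rewrite rho0_diag.
  rewrite [rho _ _ _ _ _]/= (@step_diag_monomial _ _ id) //.
  + by rewrite IH /incoming /=; congr (_%:R * _); lia.
  + by move=> j; case: (ord2P j) => ->.
- elim: t => [|t IH] x; first by rewrite rho0_diag.
  rewrite [rho _ _ _ _ _]/= (@step_diag_monomial _ _ id) //.
  + by rewrite IH /incoming /=; congr (_%:R * _); lia.
  + by move=> j; case: (ord2P j) => ->.
Qed.

(** Both entries are treated in one induction because an antidiagonal coin obtains each of them from
    the other one at the previous time. *)
Lemma rho_antidiagonal (p : R) (U : 'M[C]_2) (cR cL : C) t x :
  0 <= p <= 1 -> U 0 0 = 0 -> U 1 1 = 0 ->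
  `|U 0 1| ^+ 2 = 1 -> `|U 1 0| ^+ 2 = 1 ->
  rho p U cR cL t x x 0 0
    = (x == (odd t)%:Z)%:R * `|if odd t then cL else cR| ^+ 2 /\
  rho p U cR cL t x x 1 1
    = (x == - (odd t)%:Z)%:R * `|if odd t then cR else cL| ^+ 2.
Proof.
move=> hp U00 U11 U01 U10; elim: t x => [|t IH] x; first by rewrite !rho0_diag.
rewrite [rho _ _ _ _ _]/=; split.
- rewrite (@step_diag_monomial _ _ (fun=> 1)) //; last first.
    by move=> j; case: (ord2P j) => ->.
  rewrite (IH _).2 /incoming /=.
  by case: (odd t) => /=; congr (_%:R * _); lia.
- rewrite (@step_diag_monomial _ _ (fun=> 0)) //; last first.
    by move=> j; case: (ord2P j) => ->.
  rewrite (IH _).1 /incoming /=.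
  by case: (odd t) => /=; congr (_%:R * _); lia.
Qed.

Lemma expi0 : expi 0 = 1 :> C.
Proof. by rewrite /expi cos0 sin0. Qed.

Lemma Phat_antidiagonal (p : R) (U : 'M[C]_2) (cR cL : C) nu t :
  0 <= p <= 1 -> `|cR| ^+ 2 + `|cL| ^+ 2 = 1 -> U 0 0 = 0 -> U 1 1 = 0 ->
  `|U 0 1| ^+ 2 = 1 -> `|U 1 0| ^+ 2 = 1 ->
  Phat p U cR cL nu t
  = if odd t then `|cL| ^+ 2 * expi nu + `|cR| ^+ 2 * expi (- nu) else 1.
Proof.
move=> hp hc U00 U11 U01 U10.
rewrite (@Phat_two_points _ _ _ _ _ _ (odd t)%:Z
  (`|if odd t then cL else cR| ^+ 2) (`|if odd t then cR else cL| ^+ 2)).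
- by case: (odd t) => /=; rewrite ?mulr1 // mulr0 oppr0 expi0 !mulr1.
- by move=> x; have [] := rho_antidiagonal cR cL t x hp U00 U11 U01 U10.
- by move=> x; have [] := rho_antidiagonal cR cL t x hp U00 U11 U01 U10.
Qed.

(** * Limits of powers and phases *)

Lemma cvg_powRy (kappa : R) : 0 < kappa -> (n%:R `^ kappa) @[n --> \oo] --> +oo.
Proof.
move=> k0; apply/cvgryPge => M; near=> n.
apply: (le_trans (ler_norm M)).
rewrite -[leLHS]powRr1 // -[X in _ `^ X](mulVf (lt0r_neq0 k0)) powRrM.
apply: ge0_ler_powR; rewrite ?nnegrE ?powR_ge0 ?ler0n ?(ltW k0) //.
by near: n; move: (@cvgr_idn R) => /cvgryPge; exact.
Unshelve. all: by end_near. Qed.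

Lemma cvg_expi (u : nat -> R) :
  u @ \oo --> 0 -> (fun n => expi (u n)) @ \oo --> (1 : C^o).
Proof.
move=> u0.
have cu : cos (u n) @[n --> \oo] --> (1 : R).
  by rewrite -cos0; apply: (cvg_comp u cos u0); exact: continuous_cos.
have su : sin (u n) @[n --> \oo] --> (0 : R).
  by rewrite -(sin0 R); apply: (cvg_comp u sin u0); exact: continuous_sin.
(* In the partial order of [R[i]], a positive radius has zero imaginary part. *)
apply/(@cvgrPdist_lt C C^o) => -[e e'] /=; rewrite ltcE /= => /andP[/eqP -> e0].
have e20 : 0 < e / 2 by rewrite divr_gt0.
move/cvgrPdist_lt: cu => /(_ _ e20) cu; move/cvgrPdist_lt: su => /(_ _ e20) su.
near=> n.
have -> : 1 - expi (u n) = (1 - cos (u n))%:C + (0 +i* - sin (u n)).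
  by apply/eqP; rewrite eq_complex /= addr0 !eqxx.
apply: (le_lt_trans (ler_normD _ _)).
rewrite !normc_def /= !expr0n /= addr0 add0r sqrrN !sqrtr_sqr -rmorphD ltcR.
rewrite [e in _ < e]splitr ltrD //; first by near: n.
by rewrite -normrN -[- _]add0r; near: n.
Unshelve. all: by end_near. Qed.

(** Every neighbourhood of [l] contains [l], so replacing terms by [l] cannot spoil convergence. *)
Lemma cvg_if (T : topologicalType) (b : nat -> bool) (u : nat -> T) (l : T) :
  u @ \oo --> l -> (fun n => if b n then u n else l) @ \oo --> l.
Proof.
move=> ul A Al; move: (ul A Al); rewrite /nbhs /=; apply: filterS => n An /=.
by case: (b n) => //; exact: nbhs_singleton.
Qed.

Lemma sqr_norm_sign (a : R) : a ^+ 2 = 1 -> `|a%:C| ^+ 2 = 1 :> C.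
Proof.
move=> a1; rewrite normc_def /= expr0n /= addr0 sqrtr_sqr.
by rewrite -rmorphXn /= real_normK ?num_real // a1.
Qed.

End DiagonalBlocks.

(** * The ballistic and the oscillating case *)

Theorem mainTheorem7 (R : realType) (p theta : R) (U : 'M[R]_2) (cR cL : R[i])
    (hp : 0 <= p <= 1)
    (hU : U = rotation theta \/ U = reflection theta)
    (hc : `|cR| ^+ 2 + `|cL| ^+ 2 = 1) :
  (theta = 0 \/ theta = pi ->
     forall (nu : R) (t : nat), (1 <= t)%N ->
       Phat p (complex_mx U) cR cL (nu / t%:R) t
         = `|cR| ^+ 2 * expi nu + `|cL| ^+ 2 * expi (- nu))
  /\
  (theta = pi / 2 \/ theta = 3 * pi / 2 ->
     forall (kappa nu : R), 0 < kappa ->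
       (fun t : nat => Phat p (complex_mx U) cR cL (nu / (t%:R `^ kappa)) t)
         @ \oo --> (1 : R[i]^o)).
Proof.
(* Only squares of the entries of [U] matter, which handles rotation and reflection together. *)
have U00 : U 0 0 ^+ 2 = cos theta ^+ 2 by case: hU => ->; rewrite mxE.
have U11 : U 1 1 ^+ 2 = cos theta ^+ 2 by case: hU => ->; rewrite mxE //= sqrrN.
have U01 : U 0 1 ^+ 2 = sin theta ^+ 2 by case: hU => ->; rewrite mxE //= sqrrN.
have U10 : U 1 0 ^+ 2 = sin theta ^+ 2 by case: hU => ->; rewrite mxE.
have z (a : R) : a ^+ 2 = 0 -> a%:C = 0 by move/eqP; rewrite sqrf_eq0 => /eqP ->.
split=> [theta0 nu t t1|theta0 kappa nu k0].
  have s0 : sin theta = 0 by case: theta0 => ->; rewrite ?sin0 ?sinpi.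
  have c1 : cos theta ^+ 2 = 1 by rewrite cos2sin2 s0 expr0n subr0.
  rewrite Phat_diagonal // ?mxE ?sqr_norm_sign ?z ?U00 ?U11 ?U01 ?U10 ?s0 ?expr0n //.
  by rewrite divfK // pnatr_eq0 -lt0n.
have c0 : cos theta = 0.
  case: theta0 => ->; first exact: cos_pihalf.
  have -> : 3 * pi / 2 = pi / 2 + pi :> R by field.
  by rewrite cosDpi cos_pihalf oppr0.
have s1 : sin theta ^+ 2 = 1 by rewrite sin2cos2 c0 expr0n subr0.
pose v n : R := nu / (n%:R `^ kappa).
(* [u] is the value at odd times; at even times the value is exactly 1. *)
pose u n : R[i] := `|cL| ^+ 2 * expi (v n) + `|cR| ^+ 2 * expi (- v n).
rewrite (_ : (fun t => _) = fun t => if odd t then u t else 1); last first.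
  apply/funext => t; rewrite Phat_antidiagonal //;
    by rewrite ?mxE ?sqr_norm_sign ?z ?U00 ?U11 ?U01 ?U10 ?c0 ?expr0n.
suff ul : u @ \oo --> (1 : R[i]^o) by exact: (@cvg_if R[i]^o odd u 1 ul).
have v0 : v @ \oo --> (0 : R).
  rewrite -(mulr0 nu); apply: cvgM; first exact: cvg_cst.
  apply/gtr0_cvgV0; last exact: cvg_powRy.
  (* Positivity is taken for [n > 0] only, since [0] to a positive power is [0]. *)
  by near=> n; apply: powR_gt0; rewrite ltr0n; near: n; exact: nbhs_infty_gt.
have vN0 : (fun n => - v n) @ \oo --> (0 : R) by rewrite -oppr0; exact: cvgN v0.
have cZ (w : nat -> R) (a : R[i]) : w @ \oo --> 0 ->
    (fun n => a * expi (w n)) @ \oo --> (a : R[i]^o).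
  by move=> /cvg_expi /(@cvgZl_tmp _ R[i]^o _ _ _ a); rewrite [a *: _]mulr1.
have := @cvgD _ R[i]^o _ _ _ _ _ _ _ (cZ _ (`|cL| ^+ 2) v0) (cZ _ (`|cR| ^+ 2) vN0).
(* Both phases tend to 1, so the limit is the total weight of the initial coin state. *)
have -> : (`|cL| ^+ 2 : R[i]^o) + `|cR| ^+ 2 = 1 by rewrite addrC; exact: hc.
exact.
Unshelve. all: by end_near. Qed.
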